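(* Let $K$ be a field with $\operatorname{char}K\neq 2,3$. Let $k\geq 1$ and let $r=2k$ or $r=2k+1$. Then: - $E\otimes E_r\otimes E_2$ and $E\otimes E_r\otimes E_3$ satisfy the identity $[x_1,\dots,x_{2k+5}]=0$; - $E_r\otimes E_r\otimes E_2$ and $E_r\otimes E_r\otimes E_3$ satisfy the identity $[x_1,\dots,x_{2k+3}]=0$.
   Context: $E$ denotes the (unital) Grassmann (exterior) algebra over a $K$-vector space of countably infinite dimension, and $E_r$ ($r\ge2$) the Grassmann algebra over an $r$-dimensional $K$-vector space. $\otimes=\otimes_K$ is the ordinary (ungraded) tensor product of algebras. Long commutators are left-normed: $[u_1,u_2]=u_1u_2-u_2u_1$ and $[u_1,\dots,u_{m+1}]=[[u_1,\dots,u_m],u_{m+1}]$ for $m\ge 2$. An algebra satisfies an identity if the identity holds for all substitutions of algebra elements for the variables. *)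

(* Defs.v *)
From HB Require Import structures.
From mathcomp Require Import all_boot all_algebra ring_quotient.
From mathcomp Require Import finmap.
From mathcomp Require Import boolp classical_sets.
From mathcomp Require Import monalg.

Set Implicit Arguments.
Unset Strict Implicit.
Unset Printing Implicit Defensive.

Import GRing.Theory.
Local Open Scope ring_scope.
Local Open Scope quotient_scope.

Section Span.
Variables (K : fieldType) (V : lmodType K) (S : V -> Prop).

Definition lspan : {pred V} := fun v =>
  `[< exists2 s : seq (K * V), (forall p, p \in s -> S p.2) &
        v = \sum_(p <- s) p.1 *: p.2 >].

Lemma lspan_zmod : zmod_closed lspan.
Proof.
split; first by apply/asboolP; exists [::] => //; rewrite big_nil.
move=> _ _ /asboolP[s sS ->] /asboolP[t tS ->]; apply/asboolP.
exists (s ++ [seq (- p.1, p.2) | p <- t]).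
  move=> p; rewrite mem_cat => /orP[/sS//|/mapP[q qt ->]]; exact: tS qt.
rewrite big_cat big_map /= -sumrN; congr (_ + _).
by apply: eq_bigr => p _; rewrite scaleNr.
Qed.

Lemma lspan_scale : scaler_closed lspan.
Proof.
move=> c _ /asboolP[s sS ->]; apply/asboolP.
exists [seq (c * p.1, p.2) | p <- s].
  move=> p /mapP[q qt ->]; exact: sS qt.
by rewrite big_map scaler_sumr; apply: eq_bigr => p _; rewrite scalerA.
Qed.

HB.instance Definition _ := GRing.isZmodClosed.Build V lspan lspan_zmod.
HB.instance Definition _ := GRing.isScaleClosed.Build K V lspan lspan_scale.

Lemma mem_lspan v : S v -> v \in lspan.
Proof.
move=> Sv; apply/asboolP; exists [:: (1, v)].
  by move=> p; rewrite inE => /eqP->.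
by rewrite big_seq1 scale1r.
Qed.

(* Quotient of the K-module V by the submodule spanned by S. *)
Definition modquot := Quotient.quot lspan.
HB.instance Definition _ := GRing.Zmodule.on modquot.
HB.instance Definition _ := ZmodQuotient.on modquot.

Lemma mqP (x : modquot) : exists v, x = \pi_modquot v.
Proof. by exists (repr x); rewrite reprK. Qed.

Definition mqscale (c : K) (x : modquot) : modquot :=
  \pi_modquot (c *: repr x).

Lemma pi_mqE (u v : V) : (\pi_modquot u == \pi_modquot v) = (u - v \in lspan).
Proof. by rewrite /modquot Quotient.idealrBE. Qed.

Lemma pi_mqscale c v : mqscale c (\pi_modquot v) = \pi_modquot (c *: v).
Proof.
apply/eqP; rewrite pi_mqE -scalerBr; apply: rpredZ.
by rewrite -pi_mqE reprK.
Qed.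

Lemma mqscaleA a b x : mqscale a (mqscale b x) = mqscale (a * b) x.
Proof. by case: (mqP x) => [u ->]; rewrite !pi_mqscale scalerA. Qed.
Lemma mqscale1 : left_id 1 mqscale.
Proof. by move=> x; case: (mqP x) => [u ->]; rewrite !pi_mqscale scale1r. Qed.
Lemma mqscaleDr : right_distributive mqscale +%R.
Proof.
move=> a x y; case: (mqP x) (mqP y) => [u ->] [v ->].
by rewrite -raddfD !pi_mqscale scalerDr raddfD.
Qed.
Lemma mqscaleDl x : {morph mqscale^~ x : a b / a + b}.
Proof.
by move=> a b; case: (mqP x) => [u ->]; rewrite !pi_mqscale scalerDl raddfD.
Qed.

HB.instance Definition _ := GRing.Zmodule_isLmodule.Build K modquot
  mqscaleA mqscale1 mqscaleDr mqscaleDl.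

End Span.

Section Exterior.
Variables (K : fieldType) (I : choiceType).
Local Notation FA := {malg K[{fmonom I}]}.

(* The free algebra FA on I is the tensor algebra T(V) of the space
   V = {malg K[I]} with basis I; linform is the embedding of V in T(V). *)
Definition linform (v : {malg K[I]}) : FA :=
  \sum_(i <- msupp v) << v@_i *g fmu i >>.

Definition ext_rel (x : FA) : Prop :=
  exists a v b, x = a * (linform v * linform v) * b.

Lemma scalerAr_free (c : K) (x y : FA) : c *: (x * y) = x * (c *: y).
Proof.
have scM (g : FA) : c *: g = g * (c *: 1).
  rewrite -[c *: 1]mul_malgC mulr1 malgM_def malgZ_def fgmulgU.
  by apply: eq_bigr => k _; rewrite mulm1 mulrC.
by rewrite (scM (x * y)) (scM y) mulrA.
Qed.

Lemma ext_idealr (x y : FA) : x \in lspan ext_rel -> x * y \in lspan ext_rel.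
Proof.
case/asboolP=> s sS ->; rewrite mulr_suml big_seq; apply: rpred_sum => p /sS.
move=> [a [v [b def_p]]]; rewrite -scalerAl; apply: rpredZ; apply: mem_lspan.
exists a, v, (b * y); rewrite def_p; move: (linform v * _) => l.
exact/esym/mulrA.
Qed.

Lemma ext_ideall (x y : FA) : y \in lspan ext_rel -> x * y \in lspan ext_rel.
Proof.
case/asboolP=> s sS ->; rewrite mulr_sumr big_seq; apply: rpred_sum => p /sS.
move=> [a [v [b def_p]]]; rewrite -scalerAr_free.
apply: rpredZ; apply: mem_lspan.
exists (x * a), v, b; rewrite def_p; move: (linform v * _) => l.
have xal : x * (a * l) = x * a * l by exact: mulrA.
rewrite [LHS]mulrA xal; reflexivity.
Qed.

Lemma ext_proper : 1 \notin lspan ext_rel.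
Proof.
apply/negP => /asboolP[s sS e].
have /eqP := congr1 (fun g : FA => g@_(mone : {fmonom I})) e.
rewrite rmorph1 raddf_sum /= big_seq big1 ?oner_eq0 // => p /sS [a [v [b ->]]].
rewrite mcoeffZ !rmorphM /=.
suff -> : (linform v)@_(mone : {fmonom I}) = 0.
  by rewrite mul0r !mulr0 mul0r mulr0.
rewrite /linform raddf_sum big1 //= => i _; rewrite mcoeffU.
by rewrite -fdeg_eq0 fdegU mulr0n.
Qed.

(* The exterior algebra of V, i.e. T(V) modulo the two-sided ideal generated by
   the squares of the elements of V: the span of ext_rel is that ideal. *)
Definition exterior := modquot ext_rel.
HB.instance Definition _ := GRing.Lmodule.on exterior.
HB.instance Definition _ := ZmodQuotient.on exterior.

Lemma extP (x : exterior) : exists v, x = \pi_exterior v.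
Proof. by exists (repr x); rewrite reprK. Qed.

Definition ext_one : exterior := \pi_exterior 1.
Definition ext_mul (x y : exterior) : exterior :=
  \pi_exterior (repr x * repr y).

Lemma pi_ext_mul (x y : FA) :
  ext_mul (\pi_exterior x) (\pi_exterior y) = \pi_exterior (x * y).
Proof.
apply/eqP; rewrite pi_mqE.
set x' := repr (_ x); set y' := repr (_ y).
have -> : x' * y' - x * y = x' * (y' - y) + (x' - x) * y.
  by rewrite mulrBr mulrBl addrA subrK.
by apply: rpredD; [apply: ext_ideall | apply: ext_idealr];
  rewrite -pi_mqE reprK.
Qed.

Lemma ext_mulA : associative ext_mul.
Proof.
move=> x y z; case: (extP x) (extP y) (extP z) => [u ->] [v ->] [w ->].
by rewrite !pi_ext_mul mulrA.
Qed.
Lemma ext_mul1l : left_id ext_one ext_mul.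
Proof. by move=> x; case: (extP x) => [u ->]; rewrite pi_ext_mul mul1r. Qed.
Lemma ext_mul1r : right_id ext_one ext_mul.
Proof. by move=> x; case: (extP x) => [u ->]; rewrite pi_ext_mul mulr1. Qed.
Lemma ext_mulDl : left_distributive ext_mul +%R.
Proof.
move=> x y z; case: (extP x) (extP y) (extP z) => [u ->] [v ->] [w ->]; 
by rewrite -raddfD !pi_ext_mul mulrDl raddfD.
Qed.
Lemma ext_mulDr : right_distributive ext_mul +%R.
Proof.
move=> x y z; case: (extP x) (extP y) (extP z) => [u ->] [v ->] [w ->]; 
by rewrite -raddfD !pi_ext_mul mulrDr raddfD.
Qed.
Lemma ext_one_neq0 : ext_one != 0.
Proof.
by rewrite -(raddf0 \pi_exterior) pi_mqE subr0 ext_proper.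
Qed.

HB.instance Definition _ := GRing.Zmodule_isNzRing.Build exterior
  ext_mulA ext_mul1l ext_mul1r ext_mulDl ext_mulDr ext_one_neq0.

Lemma ext_piM (x y : FA) :
  \pi_exterior (x * y) = \pi_exterior x * \pi_exterior y.
Proof. exact/esym/pi_ext_mul. Qed.

Lemma ext_piZ (c : K) (x : FA) :
  \pi_exterior (c *: x) = c *: \pi_exterior x.
Proof. exact/esym/pi_mqscale. Qed.

Lemma ext_scaleAl (c : K) (x y : exterior) : c *: (x * y) = c *: x * y.
Proof.
case: (extP x) (extP y) => [u ->] [v ->].
by rewrite -ext_piM -!ext_piZ -ext_piM scalerAl.
Qed.
Lemma ext_scaleAr (c : K) (x y : exterior) : c *: (x * y) = x * (c *: y).
Proof.
case: (extP x) (extP y) => [u ->] [v ->].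
by rewrite -ext_piM -!ext_piZ -ext_piM scalerAr_free.
Qed.
HB.instance Definition _ :=
  GRing.Lmodule_isLalgebra.Build K exterior ext_scaleAl.
HB.instance Definition _ :=
  GRing.Lalgebra_isAlgebra.Build K exterior ext_scaleAr.

Definition ext_vec (v : {malg K[I]}) : exterior := \pi_exterior (linform v).

Lemma ext_vec_sq0 v : ext_vec v * ext_vec v = 0.
Proof.
rewrite /ext_vec -ext_piM -(raddf0 \pi_exterior); apply/eqP.
rewrite pi_mqE subr0; apply: mem_lspan; exists 1, v, 1.
by rewrite mul1r mulr1; reflexivity.
Qed.

End Exterior.

Lemma spanned_assoc (W : zmodType) (m : W -> W -> W) (G : W -> Prop) :
    left_distributive m +%R -> right_distributive m +%R ->
    (forall x, m 0 x = 0) -> (forall x, m x 0 = 0) ->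
    (forall P : W -> Prop, P 0 -> (forall g y, G g -> P y -> P (g + y)) ->
      forall x, P x) ->
    (forall g h k, G g -> G h -> G k -> m g (m h k) = m (m g h) k) ->
  associative m.
Proof.
move=> mDl mDr m0l m0r Gind mA x y z.
elim/Gind: x => [|g x Gg IHx]; first by rewrite !m0l.
rewrite !mDl IHx; congr (_ + _).
elim/Gind: y {IHx} => [|h y Gh IHy]; first by rewrite m0l m0r m0l.
rewrite mDr !mDl mDr IHy; congr (_ + _).
elim/Gind: z {IHy} => [|k z Gk IHz]; first by rewrite !m0r.
by rewrite !mDr IHz mA.
Qed.

(* Existence of a linear form mapping 1 to 1, used to show that a tensor product
   of nonzero algebras is nonzero. *)
Section UnitFunctional.
Variables (K : fieldType) (A : algType K).

Let submod_no1 (N : set A) :=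
  (forall c x y, N x -> N y -> N (c *: x + y)) /\ ~ N 1.

Lemma unit_functional : exists2 phi : A -> K,
  (forall c x y, phi (c *: x + y) = c * phi x + phi y) & phi 1 = 1.
Proof.
have [F FP Ftot|N [[Nlin N1] Nmax]] := @Zorn_bigcup A submod_no1.
  split; last by case=> X /FP[].
  move=> c x y [X FX Xx] [Y FY Yy]; have [XY|YX] := Ftot _ _ FX FY.
    by exists Y => //; apply: (FP _ FY).1 => //; exact: XY.
  by exists X => //; apply: (FP _ FX).1 => //; exact: YX.
have N0 : N 0.
  apply: contrapT => N0; have Nempty x : ~ N x.
    move=> Nx; apply: N0; rewrite -(addNr x) -scaleN1r; exact: Nlin.
  apply: (Nmax (fun x => x = 0)) => [|].
    by split=> [x /Nempty//|/(_ 0 erefl)].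
  by split=> [c x y -> ->|/eqP]; rewrite ?scaler0 ?addr0 ?oner_eq0.
have NZ c x : N x -> N (c *: x).
  by move=> Nx; rewrite -[_ *: _]addr0; exact: Nlin.
have ND x y : N x -> N y -> N (x + y).
  by move=> Nx Ny; rewrite -[x]scale1r; exact: Nlin.
have codim1 a : exists c : K, N (a - c *: 1).
  pose B : set A := fun x => exists n c, N n /\ x = n + c *: a.
  have NB : (N `<=` B)%classic.
    by move=> x Nx; exists x, 0; rewrite scale0r addr0.
  have Blin c x y : B x -> B y -> B (c *: x + y).
    move=> [m [d [Nm ->]]] [n [e [Nn ->]]].
    exists (c *: m + n), (c * d + e); split; first exact: Nlin.
    by rewrite scalerDr scalerDl scalerA addrACA.
  have [[n [c [Nn e1]]]|B1] := pselect (B 1).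
    have c0 : c != 0.
      by apply/eqP => c0; apply: N1; rewrite e1 c0 scale0r addr0.
    exists c^-1; rewrite e1 scalerDr scalerA mulVf // scale1r opprD addrCA.
    by rewrite subrr addr0 -scaleNr; exact: NZ.
  exists 0; rewrite scale0r subr0; apply: contrapT => Na.
  apply: (Nmax B) => //; split=> // /(_ a) BN; apply/Na/BN.
  by exists 0, 1; rewrite scale1r add0r.
have uniq1 a c d : N (a - c *: 1) -> N (a - d *: 1) -> c = d.
  move=> Nc Nd; apply/eqP; rewrite -subr_eq0; apply/eqP.
  apply: contrapT => /eqP cd; apply: N1.
  have -> : (1 : A) = (c - d)^-1 *: ((a - d *: 1) + (-1) *: (a - c *: 1)).
    rewrite scaleN1r opprB [X in _ *: X]addrC addrA addrNK -scalerBl scalerA.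
    by rewrite mulVf // scale1r.
  by apply/NZ/ND => //; exact: NZ.
pose phi a := projT1 (cid (codim1 a)).
have phiP a : N (a - phi a *: 1) := projT2 (cid (codim1 a)).
exists phi => [c x y|]; last by apply: (uniq1 1) => //; rewrite scale1r subrr.
apply: (uniq1 (c *: x + y)) => //.
rewrite scalerDl -scalerA opprD addrACA -scalerBr.
exact: Nlin.
Qed.

End UnitFunctional.

Section LinExt.
Variables (K : fieldType) (T : choiceType) (V : lmodType K) (f : T -> V).

Definition lin_ext (g : {malg K[T]}) : V := \sum_(p <- msupp g) g@_p *: f p.

Lemma lin_extEw (d : {fset T}) (g : {malg K[T]}) :
  (msupp g `<=` d)%fset -> lin_ext g = \sum_(p <- d) g@_p *: f p.
Proof.
move=> le; rewrite /lin_ext; apply: big_fset_incl => // p _ /mcoeff_outdom ->.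
by rewrite scale0r.
Qed.

Lemma lin_extU p : lin_ext << p >> = f p.
Proof. by rewrite (lin_extEw msuppU_le) big_seq_fset1 mcoeffUU scale1r. Qed.

Lemma lin_extP c (g h : {malg K[T]}) :
  lin_ext (c *: g + h) = c *: lin_ext g + lin_ext h.
Proof.
pose d := (msupp g `|` msupp h `|` msupp (c *: g + h)%R)%fset.
have gd : (msupp g `<=` d)%fset by rewrite /d -fsetUA fsubsetUl.
have hd : (msupp h `<=` d)%fset by rewrite /d -fsetUA fsetUCA fsubsetUl.
rewrite (lin_extEw gd) (lin_extEw hd) (@lin_extEw d); last exact: fsubsetUr.
rewrite scaler_sumr -big_split; apply: eq_bigr => p _ /=.
by rewrite mcoeffD mcoeffZ scalerDl scalerA.
Qed.

End LinExt.

Section Tensor.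
Variables (K : fieldType) (A B : algType K).
Local Notation F := {malg K[(A * B)%type]}.
Local Notation "<| a , b |>" := (<< (a, b) >> : F) (a at level 40).

Inductive tens_rel : F -> Prop :=
| TensL c a a' b :
    tens_rel (<| c *: a + a', b |> - c *: <| a, b |> - <| a', b |>)
| TensR c a b b' :
    tens_rel (<| a, c *: b + b' |> - c *: <| a, b |> - <| a, b' |>).

(* The space A ⊗ B, as the free K-module on A * B modulo the bilinearity
   relations; its product, defined below through the universal property, is the
   ungraded one: (a ⊗ b) (a' ⊗ b') = (a a') ⊗ (b b'), see pure_tensorM. *)
Definition tensor := modquot tens_rel.
HB.instance Definition _ := GRing.Lmodule.on tensor.
HB.instance Definition _ := ZmodQuotient.on tensor.

Definition pure_tensor (a : A) (b : B) : tensor := \pi_tensor <| a, b |>.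

Definition tens_lift (V : lmodType K) (f : A -> B -> V) (x : tensor) : V :=
  lin_ext (fun p => f p.1 p.2) (repr x).

Definition bilin (V : lmodType K) (f : A -> B -> V) :=
  (forall c a a' b, f (c *: a + a') b = c *: f a b + f a' b) /\
  (forall c a b b', f a (c *: b + b') = c *: f a b + f a b').

Lemma tensP (x : tensor) : exists v, x = \pi_tensor v.
Proof. by exists (repr x); rewrite reprK. Qed.

Lemma tens_piP c (x y : F) :
  \pi_tensor (c *: x + y) = c *: \pi_tensor x + \pi_tensor y.
Proof. by rewrite raddfD; congr (_ + _); exact/esym/pi_mqscale. Qed.

Lemma pure_bilin : bilin pure_tensor.
Proof.
split=> [c a a' b|c a b b']; rewrite -tens_piP; apply/eqP; rewrite pi_mqE.
  by rewrite opprD addrA; apply: mem_lspan; exact: TensL.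
by rewrite opprD addrA; apply: mem_lspan; exact: TensR.
Qed.

Section Lift.
Variables (V : lmodType K) (f : A -> B -> V).

Hypothesis fP : bilin f.
Lemma tens_lift_pi (v : F) :
  tens_lift f (\pi_tensor v) = lin_ext (fun p => f p.1 p.2) v.
Proof.
pose L (x : F) := lin_ext (fun p => f p.1 p.2) x; rewrite /tens_lift -!/(L _).
have lP c (x y : F) : L (c *: x + y) = c *: L x + L y by exact: lin_extP.
have l0 : L 0 = 0 by rewrite /L /lin_ext msupp0 big_seq_fset0.
have lZ c (x : F) : L (c *: x) = c *: L x.
  by rewrite -[c *: x]addr0 lP l0 addr0.
have lB (x y : F) : L (x - y) = L x - L y.
  by rewrite [x - y]addrC -[- y]scaleN1r lP scaleN1r addrC.
have lU a b : L <| a, b |> = f a b by exact: lin_extU.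
apply/eqP; rewrite -subr_eq0 -lB; apply/eqP.
have : repr (\pi_tensor v) - v \in lspan tens_rel by rewrite -pi_mqE reprK.
case/asboolP=> s sS ->; elim: s sS => [|p s IHs] sS; first by rewrite big_nil.
rewrite big_cons lP IHs ?addr0; last first.
  by move=> q qs; apply: sS; rewrite inE qs orbT.
have {sS IHs} := sS p (mem_head _ _); case: p => d r /= [c a a' b|c a b b'].
  by rewrite !lB lZ !lU fP.1 addrAC addrK subrr scaler0.
by rewrite !lB lZ !lU fP.2 addrAC addrK subrr scaler0.
Qed.

Lemma tens_lift_pure a b : tens_lift f (pure_tensor a b) = f a b.
Proof. by rewrite tens_lift_pi lin_extU. Qed.

Lemma tens_liftP c x y :
  tens_lift f (c *: x + y) = c *: tens_lift f x + tens_lift f y.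
Proof.
case: (tensP x) (tensP y) => [u ->] [v ->].
by rewrite -tens_piP !tens_lift_pi lin_extP.
Qed.

End Lift.

Lemma pure0l b : pure_tensor 0 b = 0.
Proof.
have := pure_bilin.1 (-1) 0 0 b.
by rewrite scaler0 addr0 scaleN1r addNr.
Qed.

Lemma pureZl c a b : pure_tensor (c *: a) b = c *: pure_tensor a b.
Proof. by have := pure_bilin.1 c a 0 b; rewrite addr0 pure0l addr0. Qed.

Lemma tens_ind (P : tensor -> Prop) :
  P 0 -> (forall a b y, P y -> P (pure_tensor a b + y)) -> forall x, P x.
Proof.
move=> P0 PD x; case: (tensP x) => v ->; rewrite [v]monalgE.
elim: (X in \sum_(k <- X) _) => [|[a b] s IHs].
  by rewrite big_nil raddf0.
rewrite big_cons; move: (v@_(a, b)) (\sum_(k <- s) _) IHs => c w IHs.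
have -> : << c *g (a, b) >> = c *: <| a, b |>.
  by apply/malgP => p; rewrite mcoeffZ !mcoeffU mulr_natr.
by rewrite tens_piP -pureZl; apply: PD.
Qed.

Section LiftTheory.
Variables (V : lmodType K) (f : A -> B -> V).
Hypothesis fP : bilin f.

Lemma tens_lift0 : tens_lift f 0 = 0.
Proof.
have := tens_liftP fP (-1) 0 0.
by rewrite scaler0 addr0 scaleN1r addNr.
Qed.

Lemma tens_liftD x y : tens_lift f (x + y) = tens_lift f x + tens_lift f y.
Proof. by have := tens_liftP fP 1 x y; rewrite !scale1r. Qed.

Lemma tens_liftZ c x : tens_lift f (c *: x) = c *: tens_lift f x.
Proof. by have := tens_liftP fP c x 0; rewrite tens_lift0 !addr0. Qed.

End LiftTheory.

Definition tens_mul (x y : tensor) : tensor :=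
  tens_lift (fun a b =>
    tens_lift (fun a' b' => pure_tensor (a * a') (b * b')) y) x.

Lemma tens_mul_bilin a b :
  bilin (fun a' b' => pure_tensor (a * a') (b * b')).
Proof.
split=> [c x x' y|c x y y']; rewrite mulrDr -scalerAr.
  exact: pure_bilin.1.
exact: pure_bilin.2.
Qed.

Lemma tens_mul_bilin2 y : bilin (fun a b =>
  tens_lift (fun a' b' => pure_tensor (a * a') (b * b')) y).
Proof.
elim/tens_ind: y => [|a0 b0 y IH]; split=> [c a a' b|c a b b'].
1,2: by rewrite !(tens_lift0 (tens_mul_bilin _ _)) scaler0 addr0.
all: rewrite !(tens_liftD (tens_mul_bilin _ _)).
all: rewrite !(tens_lift_pure (tens_mul_bilin _ _)) mulrDl -scalerAl.
  by rewrite pure_bilin.1 IH.1 scalerDr addrACA.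
by rewrite pure_bilin.2 IH.2 scalerDr addrACA.
Qed.

Lemma tens_mul_pure a b a' b' :
  tens_mul (pure_tensor a b) (pure_tensor a' b') =
  pure_tensor (a * a') (b * b').
Proof.
rewrite /tens_mul (tens_lift_pure (tens_mul_bilin2 _)).
exact: tens_lift_pure (tens_mul_bilin _ _) _ _.
Qed.

Lemma tens_mulDl : left_distributive tens_mul +%R.
Proof. by move=> x y z; exact: (tens_liftD (tens_mul_bilin2 _)). Qed.

Lemma tens_scaleAl (c : K) x y : c *: tens_mul x y = tens_mul (c *: x) y.
Proof. exact/esym/(tens_liftZ (tens_mul_bilin2 _)). Qed.

Lemma tens_mul0l y : tens_mul 0 y = 0.
Proof. exact: (tens_lift0 (tens_mul_bilin2 _)). Qed.

Lemma tens_mul_purel a b y : tens_mul (pure_tensor a b) y =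
  tens_lift (fun a' b' => pure_tensor (a * a') (b * b')) y.
Proof. exact: (tens_lift_pure (tens_mul_bilin2 _)). Qed.

Lemma tens_mulPr c x y z :
  tens_mul x (c *: y + z) = c *: tens_mul x y + tens_mul x z.
Proof.
elim/tens_ind: x => [|a b x IH]; first by rewrite !tens_mul0l scaler0 addr0.
rewrite !tens_mulDl IH !tens_mul_purel (tens_liftP (tens_mul_bilin _ _)).
by rewrite scalerDr addrACA.
Qed.

Lemma tens_mulDr : right_distributive tens_mul +%R.
Proof. by move=> x y z; have := tens_mulPr 1 x y z; rewrite !scale1r. Qed.

Lemma tens_mul0r x : tens_mul x 0 = 0.
Proof.
by have := tens_mulPr (-1) x 0 0; rewrite scaler0 addr0 scaleN1r addNr.
Qed.

Lemma tens_scaleAr (c : K) x y : c *: tens_mul x y = tens_mul x (c *: y).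
Proof. by have := tens_mulPr c x y 0; rewrite tens_mul0r !addr0. Qed.

Lemma tens_mulA : associative tens_mul.
Proof.
apply: (@spanned_assoc _ _ (fun x => exists a b, x = pure_tensor a b)).
- exact: tens_mulDl.
- exact: tens_mulDr.
- exact: tens_mul0l.
- exact: tens_mul0r.
- by move=> P P0 PD; apply: tens_ind => // a b y; apply: PD; exists a, b.
move=> _ _ _ [a [b ->]] [a' [b' ->]] [a'' [b'' ->]].
rewrite (tens_mul_pure a' b') (tens_mul_pure a b a' b') !tens_mul_pure.
by rewrite (mulrA a) (mulrA b).
Qed.

Definition tens_one : tensor := pure_tensor 1 1.

Lemma tens_mul1l : left_id tens_one tens_mul.
Proof.
elim/tens_ind => [|a b x IH]; first exact: tens_mul0r.
by rewrite (tens_mulDr tens_one) IH tens_mul_pure !mul1r.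
Qed.

Lemma tens_mul1r : right_id tens_one tens_mul.
Proof.
elim/tens_ind => [|a b x IH]; first exact: tens_mul0l.
by rewrite (tens_mulDl _ x) IH tens_mul_pure !mulr1.
Qed.

Lemma tens_one_neq0 : tens_one != 0.
Proof.
have [phi phiP phi1] := unit_functional A.
have [psi psiP psi1] := unit_functional B.
have fP : bilin (fun a b => phi a * psi b : K^o).
  split=> [c a a' b|c a b b'].
    by rewrite phiP mulrDl -mulrA.
  by rewrite psiP mulrDr mulrCA.
apply/eqP => /(congr1 (tens_lift (fun a b => phi a * psi b : K^o))).
rewrite (tens_lift_pure fP) (tens_lift0 fP) phi1 psi1 mulr1.
by apply/eqP/oner_neq0.
Qed.

HB.instance Definition _ := GRing.Zmodule_isNzRing.Build tensor
  tens_mulA tens_mul1l tens_mul1r tens_mulDl tens_mulDr tens_one_neq0.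
HB.instance Definition _ :=
  GRing.Lmodule_isLalgebra.Build K tensor tens_scaleAl.
HB.instance Definition _ :=
  GRing.Lalgebra_isAlgebra.Build K tensor tens_scaleAr.

Lemma pure_tensorM a b a' b' :
  pure_tensor a b * pure_tensor a' b' = pure_tensor (a * a') (b * b').
Proof. exact: tens_mul_pure. Qed.

End Tensor.

Notation "A ⊗ B" := (tensor A B)
  (at level 40, left associativity) : type_scope.

Definition lie (R : pzRingType) (x y : R) : R := x * y - y * x.

(* [x_1, ..., x_n], left-normed. *)
Definition long_comm (R : pzRingType) (s : seq R) : R :=
  if s is x :: s' then foldl (@lie R) x s' else 0.

(* The identity [x_1, ..., x_n] = 0. *)
Definition satisfies_long_comm (R : pzRingType) (n : nat) : Prop :=
  forall x : n.-tuple R, long_comm x = 0.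

(* Main.v *)
(* Each exterior algebra is spanned by words in its generators, and two words
   commute up to the sign (-1)^(product of their lengths).  Hence triple tensors
   w of words commute up to the sign given by the dot product of their three
   lengths, so that a left-normed commutator [w_1, ..., w_n] is a multiple of
   w_1 ... w_n, and vanishes unless at every step the lengths accumulated so far
   and those of the next factor have an odd dot product; in particular they are
   then both odd in some coordinate.  Each such step in a given coordinate
   raises by one the number of pairs of letters accumulated there, and words
   longer than the dimension vanish: this bounds n if the three spaces have
   finite dimension.  If the first one is infinite-dimensional, two consecutive
   steps cannot both be odd in the first coordinate alone, which gives a bound
   of twice the size. *)
Require Import Defs.
From mathcomp Require Import all_boot all_algebra zify.
From mathcomp Require Import monalg.

Set Implicit Arguments.
Unset Strict Implicit.
Unset Printing Implicit Defensive.

Import GRing.Theory.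
Local Open Scope ring_scope.

(** Polarisation: the cross terms of the square of [x + y] must cancel. *)
Lemma sqr0_anticomm (R : pzRingType) (x y : R) :
  x * x = 0 -> y * y = 0 -> (x + y) * (x + y) = 0 -> x * y = - (y * x).
Proof.
move=> xx yy; rewrite mulrDl !mulrDr xx yy add0r addr0 => /eqP.
by rewrite addr_eq0 => /eqP.
Qed.

(** * Words in anticommuting letters of square zero *)

Section AnticommutingWords.
Variables (K : fieldType) (A : algType K) (I : eqType) (e : I -> A).
Hypothesis e_sqr : forall i, e i * e i = 0.
Hypothesis e_anti : forall i j, e i * e j = - (e j * e i).

Local Notation word s := (\prod_(i <- s) e i).

Lemma word_letterC s i : word s * e i = (-1) ^+ size s *: (e i * word s).
Proof.
elim: s => [|j s IHs]; first by rewrite big_nil mul1r mulr1 scale1r.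
rewrite big_cons -mulrA IHs /= -scalerAr mulrA e_anti exprS mulN1r.
by rewrite mulNr scalerN scaleNr mulrA opprK.
Qed.

Lemma wordC s t :
  word s * word t = (-1) ^+ (size s * size t) *: (word t * word s).
Proof.
elim: t => [|j t IHt]; first by rewrite big_nil muln0 mul1r mulr1 scale1r.
rewrite big_cons mulrA word_letterC -scalerAl -(mulrA _ (word s)) IHt.
by rewrite -scalerAr scalerA -exprD /= mulnS mulrA.
Qed.

(** Moving the second copy of a repeated letter next to the first costs a sign and creates a
    square. *)
Lemma word_dup s : ~~ uniq s -> word s = 0.
Proof.
elim: s => //= i s IHs; rewrite negb_and negbK big_cons => /orP[|/IHs->].
  case/splitPr => s1 s2; rewrite big_cat big_cons /= !mulrA.
  rewrite -(mulrA (e i)) word_letterC -scalerAr mulrA e_sqr mul0r.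
  by rewrite scaler0 mul0r.
by rewrite mulr0.
Qed.

End AnticommutingWords.

(* An induction principle saying that [G] generates [V] as a monoid. *)
Definition spans (V : nmodType) (G : V -> Prop) : Prop :=
  forall P : V -> Prop,
    P 0 -> (forall g y, G g -> P y -> P (g + y)) -> forall x, P x.

(** * Spanning exterior algebras by words *)

Section ExteriorWords.
Variables (K : fieldType) (I : choiceType).
Local Notation FA := {malg K[{fmonom I}]}.

Lemma malgUZ (T : choiceType) (c : K) (k : T) :
  << c *g k >> = c *: << k >> :> {malg K[T]}.
Proof. by apply/malgP => p; rewrite mcoeffZ !mcoeffU mulr_natr. Qed.

Lemma linform_lin_ext v : linform v = lin_ext (fun i => << fmu i >> : FA) v.
Proof. by rewrite /linform /lin_ext; apply: eq_bigr => i _; rewrite malgUZ. Qed.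

Lemma linformD (u v : {malg K[I]}) : linform (u + v) = linform u + linform v.
Proof. by rewrite !linform_lin_ext -[u]scale1r lin_extP !scale1r. Qed.

Definition ext_gen (i : I) : exterior K I := ext_vec << i >>.

Lemma ext_gen_sqr i : ext_gen i * ext_gen i = 0.
Proof. exact: ext_vec_sq0. Qed.

Lemma ext_gen_anti i j : ext_gen i * ext_gen j = - (ext_gen j * ext_gen i).
Proof.
apply: sqr0_anticomm; [exact: ext_gen_sqr|exact: ext_gen_sqr|].
have <- : ext_vec (<< i >> + << j >> : {malg K[I]}) = ext_gen i + ext_gen j.
  by rewrite /ext_gen /ext_vec linformD raddfD.
exact: ext_vec_sq0.
Qed.

Definition ext_word (s : seq I) : exterior K I := \prod_(i <- s) ext_gen i.

Lemma ext_word_cat s t : ext_word (s ++ t) = ext_word s * ext_word t.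
Proof. exact: big_cat. Qed.

Lemma ext_wordC s t :
  ext_word s * ext_word t
    = (-1) ^+ (size s * size t) *: (ext_word t * ext_word s).
Proof. exact: wordC ext_gen_anti s t. Qed.

Lemma ext_word_pi (s : seq I) :
  \pi_(exterior K I)%qT << FMonom s >> = ext_word s.
Proof.
elim: s => [|i s IHs]; first by rewrite /ext_word big_nil -fmoneE.
have -> : << FMonom (i :: s) >> = << fmu i >> * << FMonom s >> :> FA.
  rewrite malgM_def fgmulUU mulr1 fmuE; congr mkmalgU; exact/esym/fmmulE.
rewrite ext_piM IHs /ext_word big_cons; congr (_ * _).
by rewrite /ext_gen /ext_vec linform_lin_ext lin_extU.
Qed.

Lemma ext_piP c (x y : FA) :
  \pi_(exterior K I)%qT (c *: x + y)
    = c *: \pi_(exterior K I)%qT x + \pi_(exterior K I)%qT y.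
Proof. by rewrite raddfD; congr (_ + _); exact: ext_piZ. Qed.

(** Scalars are built in because [spans] only allows sums. *)
Definition scaled_word (x : exterior K I) : Prop :=
  exists c s, x = c *: ext_word s.

Lemma spans_ext_word : spans scaled_word.
Proof.
move=> P P0 PD x; case: (extP x) => v ->; rewrite [v]monalgE.
elim: (X in \sum_(k <- X) _) => [|[s] l IHl]; first by rewrite big_nil raddf0.
rewrite big_cons malgUZ ext_piP ext_word_pi.
by apply: PD => //; exists v@_(FMonom s), s.
Qed.

End ExteriorWords.

Lemma ext_word_oversize (K : fieldType) (I : finType) (s : seq I) :
  (#|I| < size s)%N -> ext_word K s = 0.
Proof.
move=> lt_I_s; apply: word_dup; [exact: ext_gen_sqr|exact: ext_gen_anti|].
apply: contraL lt_I_s => /card_uniqP <-; rewrite -leqNgt; exact: max_card.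
Qed.

(** * Reduction of commutator identities to a spanning set *)

Section LieExpansion.
Variable R : pzRingType.

Lemma foldl_lie0 (s : seq R) : foldl (@lie R) 0 s = 0.
Proof. by elim: s => //= y s; rewrite /lie mul0r mulr0 subr0. Qed.

Lemma foldl_lieD (s : seq R) x y :
  foldl (@lie R) (x + y) s = foldl (@lie R) x s + foldl (@lie R) y s.
Proof.
elim: s x y => //= z s IHs x y; rewrite -IHs; congr foldl.
by rewrite /lie mulrDl mulrDr opprD addrACA.
Qed.

Variable G : R -> Prop.
Hypothesis G_ind : spans G.

(** Brackets are additive in each entry, so the entries after the head [a] are expanded one at a
    time. *)
Lemma foldl_lie_spanned a (s : seq R) :
  (forall t, size t = size s -> {in t, forall y, G y} ->
     foldl (@lie R) a t = 0) ->
  foldl (@lie R) a s = 0.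
Proof.
elim: s a => [|y s IHs] a Gs0 /=; first exact: (Gs0 [::]).
elim/G_ind: y {Gs0}(Gs0) => [|g y Gg IHy] Gs0.
  by rewrite /lie mulr0 mul0r subr0 foldl_lie0.
have -> : lie a (g + y) = lie a g + lie a y.
  by rewrite /lie mulrDl mulrDr opprD addrACA.
rewrite foldl_lieD IHy // addr0; apply: IHs => t size_t Gt.
apply: (Gs0 (g :: t)) => /= [|z]; first by rewrite size_t.
by rewrite inE => /predU1P[->|/Gt].
Qed.

Lemma long_comm_spanned n :
  (forall g t, size t = n -> G g -> {in t, forall y, G y} ->
     foldl (@lie R) g t = 0) ->
  satisfies_long_comm R n.+1.
Proof.
move=> Gs0 [[|x s] //= /eqP[size_s]].
apply: foldl_lie_spanned => t; rewrite size_s => {s size_s} size_t Gt.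
elim/G_ind: x => [|g y Gg IHy]; first exact: foldl_lie0.
by rewrite foldl_lieD IHy addr0; exact: Gs0.
Qed.

End LieExpansion.

Lemma lie_scaled (K : fieldType) (A : algType K) (c d e : K) (x y w : A) :
  x * y = w -> y * x = e *: w ->
  lie (c *: x) (d *: y) = (c * d * (1 - e)) *: w.
Proof.
move=> xy yx; rewrite /lie -!scalerAl -!scalerAr xy yx !scalerA.
by rewrite mulrBr scalerBl mulr1 (mulrC d c).
Qed.

(** * Spanning sets of tensor products *)

Section PureTensors.
Variables (K : fieldType) (A B : algType K).

Lemma pureDl (a a' : A) (b : B) :
  pure_tensor (a + a') b = pure_tensor a b + pure_tensor a' b.
Proof. by have := (pure_bilin A B).1 1 a a' b; rewrite !scale1r. Qed.

Lemma pureDr (a : A) (b b' : B) :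
  pure_tensor a (b + b') = pure_tensor a b + pure_tensor a b'.
Proof. by have := (pure_bilin A B).2 1 a b b'; rewrite !scale1r. Qed.

Lemma pure0r (a : A) : pure_tensor a (0 : B) = 0.
Proof. by apply: (addrI (pure_tensor a 0)); rewrite -pureDr !addr0. Qed.

Lemma pureZ2 c d (a : A) (b : B) :
  pure_tensor (c *: a) (d *: b) = (c * d) *: pure_tensor a b.
Proof.
have := (pure_bilin A B).2 d a b 0; rewrite !addr0 pure0r addr0 => pureZr.
by rewrite pureZl pureZr scalerA.
Qed.

Lemma spans_tensor (GA : A -> Prop) (GB : B -> Prop) :
  spans GA -> spans GB ->
  spans (fun x : A ⊗ B => exists a b, [/\ GA a, GB b & x = pure_tensor a b]).
Proof.
move=> spA spB P P0 PD; apply: tens_ind => // a b.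
elim/spA: a => [|ga a GAa IHa] y Py; first by rewrite pure0l add0r.
(* The remaining sum becomes a new arbitrary [y], so that [b] can be expanded in turn. *)
rewrite pureDl -addrA; move/IHa: Py; move: (_ + y) => {IHa}y.
elim/spB: b y => [|gb b GBb IHb] y Py; first by rewrite pure0r add0r.
by rewrite pureDr -addrA; apply: PD (IHb _ Py); exists ga, gb.
Qed.

End PureTensors.

(** * Commutators of triple words *)

Section TripleWords.
Variables (K : fieldType) (I1 I2 I3 : choiceType).
Local Notation T := (exterior K I1 ⊗ exterior K I2 ⊗ exterior K I3)%type.

Definition word3 (s1 : seq I1) (s2 : seq I2) (s3 : seq I3) : T :=
  pure_tensor (pure_tensor (ext_word K s1) (ext_word K s2)) (ext_word K s3).

Definition scaled_word3 (x : T) : Prop :=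
  exists c s1 s2 s3, x = c *: word3 s1 s2 s3.

Lemma word3M s1 s2 s3 t1 t2 t3 :
  word3 s1 s2 s3 * word3 t1 t2 t3 = word3 (s1 ++ t1) (s2 ++ t2) (s3 ++ t3).
Proof. by rewrite /word3 !pure_tensorM !ext_word_cat. Qed.

Lemma word3C s1 s2 s3 t1 t2 t3 :
  word3 t1 t2 t3 * word3 s1 s2 s3 =
  (-1) ^+ (size s1 * size t1 + size s2 * size t2 + size s3 * size t3) *:
    word3 (s1 ++ t1) (s2 ++ t2) (s3 ++ t3).
Proof.
rewrite /word3 !pure_tensorM (ext_wordC K t1) (ext_wordC K t2) (ext_wordC K t3).
rewrite (pureZ2 _ _ (ext_word K s1 * _) (ext_word K s2 * _)).
rewrite (pureZ2 _ _ (pure_tensor _ _) (ext_word K s3 * _)).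
rewrite -!exprD !ext_word_cat.
by rewrite (mulnC (size t1)) (mulnC (size t2)) (mulnC (size t3)).
Qed.

Lemma spans_word3 : spans scaled_word3.
Proof.
move=> P P0 PD; have spE I := @spans_ext_word K I.
apply: (spans_tensor (spans_tensor (spE I1) (spE I2)) (spE I3)) => // g y.
case=> [_ [_ [[_ [_ [[c1 [s1 ->]] [c2 [s2 ->]] ->]]] [c3 [s3 ->]] -> {g}]]].
apply: PD; exists (c1 * c2 * c3), s1, s2, s3.
rewrite (pureZ2 _ _ (ext_word K s1) (ext_word K s2)).
exact: pureZ2.
Qed.

(* [n] is the number of factors of a commutator of triple words with nonzero
   sign factors, and the [m]'s are its total lengths.  The summand [odd m1]
   encodes that two consecutive steps cannot be odd in the first coordinate
   alone. *)
Definition comm_bound (n m1 m2 m3 : nat) : Prop :=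
  (n <= 1 + m1./2 + m2./2 + m3./2)%N /\
  (n + odd m1 <= 2 + (m2./2 + m3./2).*2)%N.

(** Some coordinate has both lengths odd, so its half gains a carry. A carry in coordinate 2 or 3
    raises the second bound by 2, enough for the new factor and a change of [odd m1]. Otherwise [m1]
    and [l1] are odd, and [odd m1] drops from 1 to 0, which pays for the new factor. *)
Lemma comm_boundS n m1 m2 m3 l1 l2 l3 :
  odd (m1 * l1 + m2 * l2 + m3 * l3) -> comm_bound n m1 m2 m3 ->
  comm_bound n.+1 (m1 + l1) (m2 + l2) (m3 + l3).
Proof.
rewrite /comm_bound !halfD !oddD !oddM.
case: (odd m1) (odd m2) (odd m3) (odd l1) (odd l2) (odd l3) => [] [] [] [] [] [];
  rewrite //=; lia.
Qed.

Lemma foldl_lie_word3 c s1 s2 s3 n (t : seq T) :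
    {in t, forall y, scaled_word3 y} ->
    comm_bound n (size s1) (size s2) (size s3) ->
  foldl (@lie T) (c *: word3 s1 s2 s3) t = 0 \/
  exists c' s1' s2' s3',
    foldl (@lie T) (c *: word3 s1 s2 s3) t = c' *: word3 s1' s2' s3' /\
    comm_bound (n + size t) (size s1') (size s2') (size s3').
Proof.
elim: t c s1 s2 s3 n => [|y t IHt] c s1 s2 s3 n Gt bnd.
  by right; exists c, s1, s2, s3; rewrite addn0.
have [d [t1 [t2 [t3 ->]]]] := Gt y (mem_head _ _).
set N := (size s1 * size t1 + size s2 * size t2 + size s3 * size t3)%N.
have lieE : lie (c *: word3 s1 s2 s3) (d *: word3 t1 t2 t3) =
    (c * d * (1 - (-1) ^+ N)) *: word3 (s1 ++ t1) (s2 ++ t2) (s3 ++ t3).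
  by apply: lie_scaled; [exact: word3M | exact: word3C].
(* For even [N] the words commute and the zero persists through all later brackets. *)
rewrite /= lieE; have [oddN|evenN] := boolP (odd N); last first.
  left; rewrite -signr_odd (negbTE evenN) expr0 subrr mulr0 scale0r.
  exact: foldl_lie0.
rewrite -addSnnS; apply: IHt => [z tz|]; first by apply: Gt; rewrite inE tz orbT.
by rewrite !size_cat; exact: comm_boundS.
Qed.

Lemma long_comm_word3 n :
    (forall s1 s2 s3, comm_bound n (size s1) (size s2) (size s3) ->
       word3 s1 s2 s3 = 0) ->
  satisfies_long_comm T n.
Proof.
(* The empty commutator is 0 by convention. *)
case: n => [|n] w0; first by case=> -[].
apply: (long_comm_spanned spans_word3) => g t size_t [c [s1 [s2 [s3 ->]]]] Gt.
(* The constants 1 and 2 in [comm_bound] are the least that admit one factor of arbitrary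
   lengths. *)
have bnd1 : comm_bound 1 (size s1) (size s2) (size s3).
  by split; lia.
have [//|[c' [s1' [s2' [s3' [-> bnd]]]]]] := foldl_lie_word3 c Gt bnd1.
by rewrite w0 ?scaler0 // -size_t.
Qed.

End TripleWords.

(** * Vanishing of oversize words and the resulting identities *)

Section OversizeWords.
Variable K : fieldType.

Lemma word3_oversize1 (I1 : finType) (I2 I3 : choiceType)
    (s1 : seq I1) (s2 : seq I2) (s3 : seq I3) :
  (#|I1| < size s1)%N -> word3 K s1 s2 s3 = 0.
Proof. by move=> h; rewrite /word3 (ext_word_oversize _ h) !pure0l. Qed.

Lemma word3_oversize2 (I2 : finType) (I1 I3 : choiceType)
    (s1 : seq I1) (s2 : seq I2) (s3 : seq I3) :
  (#|I2| < size s2)%N -> word3 K s1 s2 s3 = 0.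
Proof.
by move=> h; rewrite /word3 (ext_word_oversize _ h) pure0r pure0l.
Qed.

Lemma word3_oversize3 (I3 : finType) (I1 I2 : choiceType)
    (s1 : seq I1) (s2 : seq I2) (s3 : seq I3) :
  (#|I3| < size s3)%N -> word3 K s1 s2 s3 = 0.
Proof.
by move=> h; rewrite /word3 (ext_word_oversize _ h) pure0r.
Qed.

(** One factor more than the second half of [comm_bound] permits for lengths within the dimensions;
    there the first length enters only by its parity. *)
Lemma long_comm_ext_finite2 (I1 : choiceType) (I2 I3 : finType) :
  satisfies_long_comm
    (exterior K I1 ⊗ exterior K I2 ⊗ exterior K I3)
    (3 + (#|I2|./2 + #|I3|./2).*2).
Proof.
apply: long_comm_word3 => s1 s2 s3 [_ bnd].
have [le2|] := leqP (size s2) #|I2|; last exact: word3_oversize2.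
have [le3|] := leqP (size s3) #|I3|; last exact: word3_oversize3.
have := half_leq le2; have := half_leq le3; lia.
Qed.

(** One factor more than the first half of [comm_bound] permits for lengths within the
    dimensions. *)
Lemma long_comm_ext_finite3 (I1 I2 I3 : finType) :
  satisfies_long_comm
    (exterior K I1 ⊗ exterior K I2 ⊗ exterior K I3)
    (2 + (#|I1|./2 + #|I2|./2 + #|I3|./2)).
Proof.
apply: long_comm_word3 => s1 s2 s3 [bnd _].
have [le1|] := leqP (size s1) #|I1|; last exact: word3_oversize1.
have [le2|] := leqP (size s2) #|I2|; last exact: word3_oversize2.
have [le3|] := leqP (size s3) #|I3|; last exact: word3_oversize3.
have := half_leq le1; have := half_leq le2; have := half_leq le3; lia.
Qed.

End OversizeWords.

Theorem corollary2p10 (K : fieldType) (k r : nat) :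
  2%N \notin [pchar K]%R -> 3%N \notin [pchar K]%R ->
  (1 <= k)%N -> r = (2 * k)%N \/ r = (2 * k + 1)%N ->
  [/\ satisfies_long_comm
        (exterior K nat ⊗ exterior K 'I_r ⊗ exterior K 'I_2)
        (2 * k + 5)%N,
      satisfies_long_comm
        (exterior K nat ⊗ exterior K 'I_r ⊗ exterior K 'I_3)
        (2 * k + 5)%N,
      satisfies_long_comm
        (exterior K 'I_r ⊗ exterior K 'I_r ⊗ exterior K 'I_2)
        (2 * k + 3)%N &
      satisfies_long_comm
        (exterior K 'I_r ⊗ exterior K 'I_r ⊗ exterior K 'I_3)
        (2 * k + 3)%N].
Proof.
move=> _ _ _ r_eq; have half_r : r./2 = k by lia.
(* The summand 1 is both [2./2] and [3./2], so the last factors of dimension 2 and 3 give the same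
   length. *)
have E5 : (3 + (r./2 + 1).*2 = 2 * k + 5)%N by lia.
have E3 : (2 + (r./2 + r./2 + 1) = 2 * k + 3)%N by lia.
split.
- by have := @long_comm_ext_finite2 K nat 'I_r 'I_2; rewrite !card_ord E5.
- by have := @long_comm_ext_finite2 K nat 'I_r 'I_3; rewrite !card_ord E5.
- by have := @long_comm_ext_finite3 K 'I_r 'I_r 'I_2; rewrite !card_ord E3.
- by have := @long_comm_ext_finite3 K 'I_r 'I_r 'I_3; rewrite !card_ord E3.
Qed.
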